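(* Each minimal cograph obstruction for arboricity $p$ has at most $O\big(((2p)!)^2\big)$ vertices; that is, there is a constant $C>0$ such that for every positive integer $p$, every minimal cograph obstruction for arboricity $p$ has at most $C\,((2p)!)^2$ vertices.
   Context: All graphs are finite and simple. A cograph is a graph with no induced path $P_4$ on four vertices; equivalently, a graph obtainable from $K_1$ by repeatedly applying disjoint union and complement. A minimal cograph obstruction for arboricity $p$ is a cograph whose vertex set cannot be partitioned into $p$ (possibly empty) subsets each inducing a forest, but such that the vertex set of every proper induced subgraph can be so partitioned. *)

(* Defs.v *)
From mathcomp Require Import all_boot.

Set Implicit Arguments.
Unset Strict Implicit.
Unset Printing Implicit Defensive.

(* A finite simple graph is a symmetric irreflexive relation on a finType;
   its induced subgraphs are identified with their vertex sets. *)
Definition simple_graph (T : finType) (e : rel T) : Prop :=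
  symmetric e /\ irreflexive e.

Definition induced_P4 (T : finType) (e : rel T) (a b c d : T) : bool :=
  [&& uniq [:: a; b; c; d],
      e a b, e b c, e c d,
      ~~ e a c, ~~ e a d & ~~ e b d].

Definition cograph (T : finType) (e : rel T) : Prop :=
  forall a b c d : T, ~~ induced_P4 e a b c d.

(* The bound on the size matters: ucycle also holds of [::] and, for
   symmetric e, of the two ends of an edge. *)
Definition induces_forest (T : finType) (e : rel T) (S : {set T}) : Prop :=
  forall c : seq T, {subset c <= S} -> 2 < size c -> ~ ucycle e c.

Definition forest_partitionable (T : finType) (e : rel T) (p : nat)
    (A : {set T}) : Prop :=
  exists V : 'I_p -> {set T},
    [/\ \bigcup_(i < p) V i = A,
        forall i j : 'I_p, i != j -> [disjoint V i & V j]
      & forall i : 'I_p, induces_forest e (V i)].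

Definition minimal_cograph_obstruction (T : finType) (e : rel T) (p : nat)
    : Prop :=
  [/\ cograph e,
      ~ forest_partitionable e p [set: T]
    & forall A : {set T}, A \proper [set: T] -> forest_partitionable e p A].

(* Main.v *)
(* Call A coverable for (a, b, c) if it is partitioned into a forests, b stable
   sets and c single vertices.  A cograph with at least two vertices is a join or
   a disjoint union of two parts A1, A2.  In a join, a forest meeting both parts
   is a star, that is, a single vertex of one part and a stable set of the other;
   hence a cover of the join for (a, b, c) amounts to covers of A1 and A2 for
   triples whose weights 2a + b + c add up to the weight of (a, b, c).  In a
   disjoint union only c is shared between the parts.  By induction on the number
   of vertices, a set that is not coverable for a triple of weight w contains a
   non-coverable subset of size at most N(w): if no part fails for (a, b, c)
   itself, take in each part the union of the small witnesses for all failing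
   triples of smaller weight.  Counting triples gives
   N(w+1) = N(w) (1 + (w+2)^2/2), hence N(w) <= 4 (w!)^2, and a minimal
   obstruction for arboricity p fails for (p, 0, 0), of weight 2p. *)
Require Import Defs.
From mathcomp Require Import all_boot zify.
From Stdlib Require Import Classical.

Section Cograph.

Variables (T : finType) (e : rel T).
Implicit Types (x y v : T) (A B F I X Y : {set T}).

(** * Cographs split as joins or disjoint unions *)

Definition anticomplete (r : rel T) A B := forall x y, x \in A -> y \in B -> ~~ r x y.
Definition complete (r : rel T) A B := forall x y, x \in A -> y \in B -> r x y.

Definition splits (r : rel T) A := exists A1 A2,
  [/\ A1 != set0, A2 != set0, [disjoint A1 & A2], A1 :|: A2 = A
    & anticomplete r A1 A2 \/ complete r A1 A2].

Definition compl_rel (r : rel T) : rel T := fun x y => (x != y) && ~~ r x y.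

Lemma compl_rel_sym r : symmetric r -> symmetric (compl_rel r).
Proof. by move=> rs x y; rewrite /compl_rel eq_sym rs. Qed.

(** The path on four vertices is self-complementary: an induced path [a b c d] of the complement is
    an induced path [b d a c] of [r]. *)
Lemma compl_rel_cograph r : symmetric r -> cograph r -> cograph (compl_rel r).
Proof.
move=> rs rc a b c d; apply/negP; rewrite /induced_P4 /compl_rel /= !inE !negb_or.
case/and5P=> /and4P[/and3P[ab ac ad] /andP[bc bd] cd _].
rewrite ab ac ad bc bd cd /= !negbK => nab nbc ncd /and3P[rac rad rbd].
have /negP[] := rc b d a c.
rewrite /induced_P4 /= !inE !negb_or bd bc ac (eq_sym b a) ab (eq_sym d a) ad (eq_sym d c) cd.
by rewrite rbd (rs d a) rad rac (rs b a) nab nbc (rs d c) ncd.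
Qed.

Lemma splits_compl r A : splits (compl_rel r) A -> splits r A.
Proof.
case=> A1 [A2 [n1 n2 dis def h]]; exists A1, A2; split=> //.
have ne x y : x \in A1 -> y \in A2 -> x != y.
  by move=> x1 y2; apply: contraTneq y2 => <-; rewrite (disjointFr dis x1).
case: h => h; [right|left] => x y x1 y2; have := h x y x1 y2;
  by rewrite /compl_rel ne ?negbK.
Qed.

(** If [v] is adjacent to everything else, it is one side of a join. Otherwise it has a
    non-neighbour [y], by symmetry in the first part, and [key] finds a side that no edge leaves:
    the second part if [v] has no neighbour there, and else the set [M]. *)
Lemma splits_add r v A1 A2 : symmetric r -> cograph r ->
  A1 != set0 -> A2 != set0 -> v \notin A1 :|: A2 -> [disjoint A1 & A2] ->
  anticomplete r A1 A2 -> splits r (v |: (A1 :|: A2)).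
Proof.
move=> rs rc.
have key B1 B2 y : B1 != set0 -> B2 != set0 -> v \notin B1 :|: B2 ->
    [disjoint B1 & B2] -> anticomplete r B1 B2 -> y \in B1 -> ~~ r v y ->
    splits r (v |: (B1 :|: B2)).
  move=> n1 n2 vn dis ac yB vy.
  have [vB1 vB2] : v \notin B1 /\ v \notin B2 by apply/norP; rewrite -in_setU.
  have [/exists_inP[z z2 vz]|/exists_inPn noz] := boolP [exists z in B2, r v z]; last first.
    exists B2, (v |: B1); split=> //.
    - by apply/set0Pn; exists v; rewrite !inE eqxx.
    - rewrite -setI_eq0; apply/eqP/setP=> u; rewrite !inE; apply/negP.
      case/andP=> u2 /orP[/eqP uv|u1]; first by rewrite -uv u2 in vB2.
      by rewrite (disjointFr dis u1) in u2.
    - by rewrite setUCA (setUC B2).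
    - left=> a b a2 /setU1P[->|b1]; first by rewrite rs; apply: noz.
      by rewrite rs; apply: ac.
  (* An edge from [y'] in [M] to a neighbour [x] of [v] in [B1] would give the induced path
     [y' x v z], so no edge leaves [M]. *)
  pose M := [set u in B1 | ~~ r v u].
  have [/exists_inP[x /andP[x1 vx] /exists_inP[y' y'M xy]]|noE] :=
      boolP [exists x in [pred x in B1 | r v x], [exists y' in M, r x y']].
    move: y'M; rewrite !inE => /andP[y'1 vy'].
    have /negP[] := rc y' x v z.
    have nez u : u \in B1 -> u != z.
      by move=> u1; apply: contraTneq z2 => <-; rewrite (disjointFr dis u1).
    have nev u : u \in B1 -> u != v by move=> u1; apply: contraNneq vB1 => <-.
    rewrite /induced_P4 /= !inE !negb_or (nez y') // (nez x) // (nev y') // (nev x) //.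
    have -> : v != z by apply: contraNneq vB2 => ->.
    have -> : y' != x by apply: contraNneq vy' => ->.
    by rewrite (rs y' x) xy (rs x v) vx vz (rs y' v) vy' (ac y') // (ac x).
  exists M, ((v |: (B1 :|: B2)) :\: M); split.
  - by apply/set0Pn; exists y; rewrite !inE yB.
  - by apply/set0Pn; exists v; rewrite !inE eqxx (negbTE vB1).
  - by rewrite -setI_eq0; apply/eqP/setP=> u; rewrite !inE; case: (u \in B1); case: (r v u); rewrite ?andbF.
  - apply/setP=> u; rewrite !inE; case: (u \in B1); case: (r v u); rewrite ?andbF ?orbT //=.
  - left=> a b aM; rewrite !inE => /andP[bM]; case/or3P=> [/eqP->|b1|b2].
    + by rewrite rs; move: aM; rewrite inE => /andP[].
    + apply/negP=> ab; case/exists_inP: noE; exists b.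
        by rewrite inE /= b1; move: bM; rewrite b1 negbK.
      by apply/exists_inP; exists a => //; rewrite rs.
    + by apply: ac => //; move: aM; rewrite inE => /andP[].
move=> n1 n2 vn dis ac.
have [/exists_inP[y y12 vy]|/exists_inPn all_nb] := boolP [exists y in A1 :|: A2, ~~ r v y].
  case/setUP: y12 => yA; first exact: (key _ _ y).
  rewrite (setUC A1); apply: (key _ _ y) => //; rewrite 1?setUC 1?disjoint_sym //.
  by move=> a b a2 b1; rewrite rs; apply: ac.
exists [set v], (A1 :|: A2); split=> //.
- by apply/set0Pn; exists v; rewrite set11.
- by case/set0Pn: n1 => u u1; apply/set0Pn; exists u; rewrite inE u1.
- by rewrite disjoints1.
- by right=> a b /set1P-> /all_nb; rewrite negbK.
Qed.

Lemma cograph_splits A : symmetric e -> cograph e -> 1 < #|A| -> splits e A.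
Proof.
move=> es ec; have [n] := ubnP #|A|; elim: n A => // n IH A An A1.
have [v vA] : exists v, v \in A by apply/card_gt0P; lia.
have cA := cardsD1 v A; rewrite vA /= in cA.
have vD : v \notin A :\ v by rewrite !inE eqxx.
have [D1|D1] := leqP #|A :\ v| 1.
  have [u uD] : exists u, A :\ v = [set u] by apply/cards1P; lia.
  exists [set v], [set u]; rewrite -uD setD1K // disjoints1; split=> //.
  - by apply/set0Pn; exists v; rewrite set11.
  - by rewrite -card_gt0; lia.
  - case evu: (e v u); [right|left]; rewrite uD => x y /set1P-> /set1P->; by rewrite evu.
case: (IH (A :\ v)) => // [|B1 [B2 [n1 n2 dis def h]]]; first lia.
rewrite -(setD1K vA) -def; rewrite -def in vD.
case: h => h; first exact: splits_add.
(* A join is a disjoint union in the complement, which is again a cograph. *)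
apply: splits_compl; apply: splits_add => //; first exact: compl_rel_sym.
  exact: compl_rel_cograph.
by move=> x y x1 y2; rewrite /compl_rel h // andbF.
Qed.

(** * Covers by forests, stable sets and single vertices *)

Definition stable I := forall x y, x \in I -> y \in I -> ~~ e x y.

(** The removed sets need not lie inside [A], so the same sets also cover every subset of [A]. *)
Inductive coverable : {set T} -> nat -> nat -> nat -> Prop :=
| Cover0 : coverable set0 0 0 0
| CoverForest A a b c F : induces_forest e F -> coverable (A :\: F) a b c ->
    coverable A a.+1 b c
| CoverStable A a b c I : stable I -> coverable (A :\: I) a b c ->
    coverable A a b.+1 c
| CoverVertex A a b c x : coverable (A :\ x) a b c -> coverable A a b c.+1.

Lemma coverableS A B a b c : B \subset A -> coverable A a b c -> coverable B a b c.
Proof.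
move=> BA cA; elim: cA B BA => {A a b c} [|A a b c F fF _ IH|A a b c I sI _ IH|A a b c x _ IH] B BA.
- by move: BA; rewrite subset0 => /eqP->; apply: Cover0.
- by apply: (CoverForest _ _ _ _ _ fF); apply: IH; apply: setSD.
- by apply: (CoverStable _ _ _ _ _ sI); apply: IH; apply: setSD.
- by apply: (CoverVertex _ _ _ _ x); apply: IH; apply: setSD.
Qed.

Lemma setDDC A B F : A :\: B :\: F = A :\: F :\: B.
Proof. by rewrite !setDDl setUC. Qed.

(** Set differences commute, so a forest removed anywhere in the derivation can be removed first.
    The next two lemmas do the same for stable sets and vertices. *)
Lemma coverable_forest A a b c : coverable A a.+1 b c ->
  exists2 F, induces_forest e F & coverable (A :\: F) a b c.
Proof.
move En: a.+1 => n cA; elim: cA a En => {A n b c} [|A a b c F fF cA _|A a b c I sI _ IH|A a b c x _ IH] // k.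
- by case=> ->; exists F.
- by case/IH=> F fF cF; exists F => //; apply: (CoverStable _ _ _ _ _ sI); rewrite setDDC.
- by case/IH=> F fF cF; exists F => //; apply: (CoverVertex _ _ _ _ x); rewrite setDDC.
Qed.

Lemma coverable_stable A a b c : coverable A a b.+1 c ->
  exists2 I, stable I & coverable (A :\: I) a b c.
Proof.
move En: b.+1 => n cA; elim: cA b En => {A a n c} [|A a b c F fF _ IH|A a b c I sI cA _|A a b c x _ IH] // k.
- by case/IH=> I sI cI; exists I => //; apply: (CoverForest _ _ _ _ _ fF); rewrite setDDC.
- by case=> ->; exists I.
- by case/IH=> I sI cI; exists I => //; apply: (CoverVertex _ _ _ _ x); rewrite setDDC.
Qed.

Lemma coverable_vertex A a b c : coverable A a b c.+1 ->
  exists x, coverable (A :\ x) a b c.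
Proof.
move En: c.+1 => n cA; elim: cA c En => {A a b n} [|A a b c F fF _ IH|A a b c I sI _ IH|A a b c x cA _] // k.
- by case/IH=> x cx; exists x; apply: (CoverForest _ _ _ _ _ fF); rewrite setDDC.
- by case/IH=> x cx; exists x; apply: (CoverStable _ _ _ _ _ sI); rewrite setDDC.
- by case=> ->; exists x.
Qed.

Lemma coverable_set0 A : coverable A 0 0 0 -> A = set0.
Proof.
move Ek: {1}0 => k; move El: {1}0 => l; move Em: {1}0 => m cA.
by case: cA Ek El Em.
Qed.

(** * Forests and stable sets across a join or a disjoint union *)

Lemma forestS F F' : F' \subset F -> induces_forest e F -> induces_forest e F'.
Proof. by move/subsetP=> sF fF c sc; apply: fF => x /sc/sF. Qed.

Hypotheses (es : symmetric e) (ei : irreflexive e).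

(** A cycle with at least three vertices has an edge avoiding [x], and both ends of that edge would
    lie in [I]. *)
Lemma forest_star x I : stable I -> induces_forest e (x |: I).
Proof.
move=> sI [|y0 [|y1 [|y2 s]]] // sc _ /andP[/= cyc un].
have inI y : y \in [:: y0, y1, y2 & s] -> y != x -> y \in I.
  by move=> /sc/setU1P[->|//]; rewrite eqxx.
have noe y z : y \in [:: y0, y1, y2 & s] -> z \in [:: y0, y1, y2 & s] ->
    e y z -> y != x -> z != x -> False.
  by move=> yc zc eyz yx zx; have /negP := sI y z (inI _ yc yx) (inI _ zc zx).
case/and3P: cyc => e01 e12 cyc.
case/and4P: un; rewrite !inE !negb_or => /and3P[n01 n02 n0s] /andP[n12 n1s] n2s us.
have [y1x|y1x] := eqVneq y1 x.
  subst x; case: s => [|y3 s] in sc inI noe cyc n0s n1s n2s us *.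
    by move: cyc; rewrite /= andbT => e20; apply: (noe _ _ _ _ e20);
      rewrite ?inE ?eqxx ?orbT // eq_sym.
  move: n1s; rewrite inE negb_or => /andP[n13 _].
  by case/andP: cyc => e23 _; apply: (noe _ _ _ _ e23);
      rewrite ?inE ?eqxx ?orbT // eq_sym.
have [y0x|y0x] := eqVneq y0 x.
  by apply: (noe _ _ _ _ e12); rewrite ?inE ?eqxx ?orbT // -y0x eq_sym.
by apply: (noe _ _ _ _ e01); rewrite ?inE ?eqxx ?orbT.
Qed.

(** A cycle never leaves the side in which it starts. *)
Lemma forestU F1 F2 : anticomplete e F1 F2 -> induces_forest e F1 ->
  induces_forest e F2 -> induces_forest e (F1 :|: F2).
Proof.
have stay G1 G2 x s : anticomplete e G1 G2 -> {subset s <= G1 :|: G2} ->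
    x \in G1 -> path e x s -> {subset s <= G1}.
  move=> ac; elim: s x => // y s IH x sc x1 /= /andP[exy ps].
  have y1 : y \in G1.
    have /setUP[//|y2] := sc y (mem_head y s).
    by have := ac x y x1 y2; rewrite exy.
  move=> z /predU1P[->//|zs]; apply: (IH y) => // u us; apply: sc; exact: mem_behead.
move=> ac f1 f2 [//|x s] sc sz cyc.
have ps : path e x s by case/andP: cyc => /=; rewrite rcons_path => /andP[].
have sc' : {subset s <= F1 :|: F2} by move=> y ys; apply: sc; exact: mem_behead.
have /setUP[x1|x2] := sc x (mem_head x s).
  apply: (f1 _ _ sz cyc) => y /predU1P[->//|]; exact: (stay F1 F2 x).
apply: (f2 _ _ sz cyc) => y /predU1P[->//|]; apply: (stay F2 F1 x) => //; last by rewrite setUC.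
by move=> u v u2 v1; rewrite es; apply: ac.
Qed.

(** An edge inside [F :&: A2] would form a triangle with [x]. *)
Lemma forest_complete_star A1 A2 F x : complete e A1 A2 -> induces_forest e F ->
  x \in F :&: A1 -> stable (F :&: A2).
Proof.
move=> cm fF /setIP[xF x1] y z /setIP[yF y2] /setIP[zF z2]; apply/negP=> yz.
apply: (fF [:: x; y; z]) => //; first by apply/allP; rewrite /= xF yF zF.
have xy := cm x y x1 y2; have xz := cm x z x1 z2.
have ne u v : e u v -> u != v by apply: contraTneq => ->; rewrite ei.
by rewrite /ucycle /= !inE !negb_or (ne x y) // (ne x z) // (ne y z) // xy yz es xz.
Qed.

Lemma forest_complete A1 A2 F : complete e A1 A2 -> induces_forest e F ->
  [\/ F :&: A1 = set0, F :&: A2 = set0,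
      exists2 x, F :&: A1 \subset [set x] & stable (F :&: A2)
    | exists2 x, F :&: A2 \subset [set x] & stable (F :&: A1)].
Proof.
move=> cm fF; have cm' : complete e A2 A1 by move=> x y x2 y1; rewrite es; apply: cm.
have [|ne1] := eqVneq (F :&: A1) set0; first by constructor 1.
have [|ne2] := eqVneq (F :&: A2) set0; first by constructor 2.
have [x xF] := set0Pn _ ne1; have [y yF] := set0Pn _ ne2.
have [le1|/card_gt1P[x1 [x2 [x1F x2F nx]]]] := leqP #|F :&: A1| 1.
  constructor 3; exists x; last exact: forest_complete_star cm fF xF.
  by apply/subsetP=> u uF; rewrite inE (card_le1_eqP le1 u x uF xF).
have [le2|/card_gt1P[y1 [y2 [y1F y2F ny]]]] := leqP #|F :&: A2| 1.
  constructor 4; exists y; last exact: forest_complete_star cm' fF yF.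
  by apply/subsetP=> u uF; rewrite inE (card_le1_eqP le2 u y uF yF).
case/setIP: x1F => x1F x1A; case/setIP: x2F => x2F x2A.
case/setIP: y1F => y1F y1A; case/setIP: y2F => y2F y2A.
(* Two vertices of [F] on each side of the join form a four-cycle. *)
case: (fF [:: x1; y1; x2; y2]) => //; first by apply/allP; rewrite /= x1F x2F y1F y2F.
have ne u v : u \in A1 -> v \in A2 -> u != v.
  by move=> uA vA; apply: contraTneq (cm u v uA vA) => ->; rewrite ei.
rewrite /ucycle /= !inE !negb_or (cm x1 y1) // (es y1) (cm x2 y1) // (cm x2 y2) //.
by rewrite (es y2) (cm x1 y2) // nx ny (eq_sym y1 x2) (ne x1 y1) // (ne x1 y2) // (ne x2 y1) // (ne x2 y2).
Qed.

Lemma stable_complete A1 A2 I : complete e A1 A2 -> stable I ->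
  I :&: A1 = set0 \/ I :&: A2 = set0.
Proof.
move=> cm sI; have [|/set0Pn[x /setIP[xI x1]]] := eqVneq (I :&: A1) set0; first by left.
right; apply/setP=> y; rewrite !inE; apply/negP=> /andP[yI y2].
by have := sI x y xI yI; rewrite cm.
Qed.

(** * Splitting a cover between the two parts *)

Lemma coverable_setIDr X F A a b c : F :&: A = set0 ->
  coverable ((X :\: F) :&: A) a b c -> coverable (X :&: A) a b c.
Proof.
move=> FA; apply: coverableS; apply/subsetP=> u; rewrite !inE => /andP[uX uA].
by rewrite uX uA !andbT; apply/negP=> uF; move/setP/(_ u): FA; rewrite !inE uF uA.
Qed.

Lemma coverable_setUD Y1 Y2 F1 F2 a b c :
  coverable ((Y1 :\: F1) :|: (Y2 :\: F2)) a b c ->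
  coverable ((Y1 :|: Y2) :\: (F1 :|: F2)) a b c.
Proof.
apply: coverableS; apply/subsetP=> u; rewrite !inE.
by case: (u \in Y1); case: (u \in Y2); case: (u \in F1); case: (u \in F2).
Qed.

Lemma coverable_setUDl Y1 Y2 F a b c :
  coverable ((Y1 :\: F) :|: Y2) a b c -> coverable ((Y1 :|: Y2) :\: F) a b c.
Proof. by move=> h; rewrite -[F]setU0; apply: coverable_setUD; rewrite setD0. Qed.

Lemma coverable_setUDr Y1 Y2 F a b c :
  coverable (Y1 :|: (Y2 :\: F)) a b c -> coverable ((Y1 :|: Y2) :\: F) a b c.
Proof. by move=> h; rewrite -[F]set0U; apply: coverable_setUD; rewrite setD0. Qed.

(** Other triples of equal weight are excluded on purpose: in [small_witness], lower weights are
    handled by [witness_below], and the triple itself by the assumption that both parts are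
    coverable for it. *)
Definition dominated a1 b1 c1 a b c :=
  2 * a1 + b1 + c1 < 2 * a + b + c \/ a1 = a /\ b1 = b /\ c1 = c.

(* The witnesses a1, ..., c2 come from the possibly small set X, but the last
   clause lets them recombine covers of arbitrary parts of A1 and A2. *)
Definition decomposable A1 A2 X a b c := exists a1 b1 c1 a2 b2 c2,
  [/\ dominated a1 b1 c1 a b c /\ dominated a2 b2 c2 a b c,
      coverable (X :&: A1) a1 b1 c1, coverable (X :&: A2) a2 b2 c2
    & forall Y1 Y2, Y1 \subset A1 -> Y2 \subset A2 -> coverable Y1 a1 b1 c1 ->
        coverable Y2 a2 b2 c2 -> coverable (Y1 :|: Y2) a b c].

Lemma decomposableC A1 A2 X a b c :
  decomposable A1 A2 X a b c -> decomposable A2 A1 X a b c.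
Proof.
case=> a1 [b1 [c1 [a2 [b2 [c2 [[d1 d2] h1 h2 h]]]]]].
exists a2, b2, c2, a1, b1, c1; split=> // Y2 Y1 s2 s1 h2' h1'.
by rewrite setUC; apply: h.
Qed.

Lemma decomposable0 A1 A2 : decomposable A1 A2 set0 0 0 0.
Proof.
exists 0, 0, 0, 0, 0, 0; rewrite !set0I; split; try exact: Cover0.
  by split; right.
by move=> Y1 Y2 _ _ /coverable_set0-> /coverable_set0->; rewrite setU0; apply: Cover0.
Qed.

Lemma setD_subset A B F : A \subset B -> A :\: F \subset B.
Proof. exact: subset_trans (subsetDl _ _). Qed.

(** The forest is charged to [A1] alone, so the weight on the side of [A2] becomes strictly smaller
    than the new total. The next two lemmas follow the same pattern. *)
Lemma decomposable_forest A1 A2 X F a b c : induces_forest e F -> F :&: A2 = set0 ->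
  decomposable A1 A2 (X :\: F) a b c -> decomposable A1 A2 X a.+1 b c.
Proof.
move=> fF F0 [a1 [b1 [c1 [a2 [b2 [c2 [[d1 d2] h1 h2 h]]]]]]].
exists a1.+1, b1, c1, a2, b2, c2; split.
- by split; move: d1 d2; rewrite /dominated; lia.
- by apply: CoverForest fF _; rewrite -setIDAC.
- exact: coverable_setIDr h2.
move=> Y1 Y2 s1 s2 /coverable_forest[F' fF' c1'] c2'.
by apply: CoverForest fF' _; apply: coverable_setUDl; apply: h => //; apply: setD_subset.
Qed.

Lemma decomposable_stable A1 A2 X I a b c : stable I -> I :&: A2 = set0 ->
  decomposable A1 A2 (X :\: I) a b c -> decomposable A1 A2 X a b.+1 c.
Proof.
move=> sI I0 [a1 [b1 [c1 [a2 [b2 [c2 [[d1 d2] h1 h2 h]]]]]]].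
exists a1, b1.+1, c1, a2, b2, c2; split.
- by split; move: d1 d2; rewrite /dominated; lia.
- by apply: CoverStable sI _; rewrite -setIDAC.
- exact: coverable_setIDr h2.
move=> Y1 Y2 s1 s2 /coverable_stable[I' sI' c1'] c2'.
by apply: CoverStable sI' _; apply: coverable_setUDl; apply: h => //; apply: setD_subset.
Qed.

Lemma decomposable_vertex A1 A2 X x a b c : x \notin A2 ->
  decomposable A1 A2 (X :\ x) a b c -> decomposable A1 A2 X a b c.+1.
Proof.
move=> x2 [a1 [b1 [c1 [a2 [b2 [c2 [[d1 d2] h1 h2 h]]]]]]].
exists a1, b1, c1.+1, a2, b2, c2; split.
- by split; move: d1 d2; rewrite /dominated; lia.
- by apply: (CoverVertex _ _ _ _ x); rewrite -setIDAC.
- apply: coverable_setIDr h2; apply/setP=> u; rewrite !inE.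
  by case: eqP => // ->; rewrite (negbTE x2).
move=> Y1 Y2 s1 s2 /coverable_vertex[y c1'] c2'.
by apply: (CoverVertex _ _ _ _ y); apply: coverable_setUDl; apply: h => //; apply: setD_subset.
Qed.

(* Any vertex together with any stable set induces a forest, so the star may be
   centred at whichever vertex the cover of Y1 leaves free. *)
Lemma decomposable_star A1 A2 X F x a b c : F :&: A1 \subset [set x] -> stable (F :&: A2) ->
  decomposable A1 A2 (X :\: F) a b c -> decomposable A1 A2 X a.+1 b c.
Proof.
move=> Fx sF [a1 [b1 [c1 [a2 [b2 [c2 [[d1 d2] h1 h2 h]]]]]]].
(* A star adds 2 to the total weight but only 1 to each side, its centre in [A1] and its leaves in
   [A2]; both sides therefore become strictly smaller. *)
exists a1, b1, c1.+1, a2, b2.+1, c2; split.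
- by split; move: d1 d2; rewrite /dominated; lia.
- apply: (CoverVertex _ _ _ _ x); apply: coverableS h1; apply/subsetP=> u.
  rewrite !inE => /and3P[ux uX u1]; rewrite uX u1 !andbT.
  apply: contra ux => uF; rewrite -in_set1; apply: (subsetP Fx).
  by rewrite inE uF.
- apply: CoverStable sF _; apply: coverableS h2; apply/subsetP=> u.
  by rewrite !inE => /and3P[uF uX u2]; rewrite uX u2 in uF *; rewrite andbT in uF; rewrite uF.
move=> Y1 Y2 s1 s2 /coverable_vertex[y c1'] /coverable_stable[I sI c2'].
apply: (CoverForest _ _ _ _ _ (forest_star y I sI)); apply: coverable_setUD.
by apply: h => //; apply: setD_subset.
Qed.

Lemma decompose_complete A1 A2 X a b c : complete e A1 A2 ->
  coverable X a b c -> decomposable A1 A2 X a b c.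
Proof.
move=> cm; elim=> {X a b c} [|X a b c F fF _ IH|X a b c I sI _ IH|X a b c x _ IH].
- exact: decomposable0.
- case: (forest_complete A1 A2 F cm fF) => [F0|F0|[x Fx sF]|[x Fx sF]].
  + by apply: decomposableC; apply: decomposable_forest fF F0 _; apply: decomposableC.
  + exact: decomposable_forest fF F0 _.
  + exact: decomposable_star Fx sF _.
  + by apply: decomposableC; apply: decomposable_star Fx sF _; apply: decomposableC.
- case: (stable_complete A1 A2 I cm sI) => I0.
  + by apply: decomposableC; apply: decomposable_stable sI I0 _; apply: decomposableC.
  + exact: decomposable_stable sI I0 _.
- have [x1|x1] := boolP (x \in A1).
  + apply: decomposable_vertex IH; apply/negP=> x2.
    by have := cm x x x1 x2; rewrite ei.
  + by apply: decomposableC; apply: decomposable_vertex x1 _; apply: decomposableC.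
Qed.

Lemma decompose_anticomplete A1 A2 X a b c : [disjoint A1 & A2] -> anticomplete e A1 A2 ->
  coverable X a b c -> decomposable A1 A2 X a b c.
Proof.
move=> dis ac; have ac' : anticomplete e A2 A1.
  by move=> x y x2 y1; rewrite es; apply: ac.
(* Forests, and likewise stable sets, of the two parts can be united, so both sides keep [a] and
   [b]. The induction needs this explicitly in order to pair them up. *)
suff main : coverable X a b c -> exists c1 c2,
  [/\ c1 <= c /\ c2 <= c, coverable (X :&: A1) a b c1, coverable (X :&: A2) a b c2
    & forall Y1 Y2, Y1 \subset A1 -> Y2 \subset A2 -> coverable Y1 a b c1 ->
        coverable Y2 a b c2 -> coverable (Y1 :|: Y2) a b c].
  case/main=> c1 [c2 [[l1 l2] h1 h2 h]]; exists a, b, c1, a, b, c2; split=> //.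
  by rewrite /dominated; lia.
elim=> {X a b c} [|X a b c F fF _ IH|X a b c I sI _ IH|X a b c x _ IH].
- exists 0, 0; rewrite !set0I; split; try exact: Cover0; first by [].
  by move=> Y1 Y2 _ _ /coverable_set0-> /coverable_set0->; rewrite setU0; apply: Cover0.
- case: IH => c1 [c2 [l h1 h2 h]]; exists c1, c2; split=> //.
  + by apply: CoverForest fF _; rewrite -setIDAC.
  + by apply: CoverForest fF _; rewrite -setIDAC.
  move=> Y1 Y2 s1 s2 /coverable_forest[F1 f1 d1] /coverable_forest[F2 f2 d2].
  (* [F1] and [F2] may reach outside their parts; only after trimming is the union known to be a
     forest. *)
  apply: (@CoverForest _ _ _ _ ((F1 :&: A1) :|: (F2 :&: A2))).
    apply: forestU; try by apply: forestS; [exact: subsetIl|].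
    by move=> x y /setIP[_ x1] /setIP[_ y2]; apply: ac.
  apply: coverable_setUD; apply: h; rewrite ?setD_subset //.
  + apply: coverableS d1; apply/subsetP=> u; rewrite !inE => /andP[nu uY].
    by move: nu; rewrite uY (subsetP s1 _ uY) !andbT.
  + apply: coverableS d2; apply/subsetP=> u; rewrite !inE => /andP[nu uY].
    by move: nu; rewrite uY (subsetP s2 _ uY) !andbT.
- case: IH => c1 [c2 [l h1 h2 h]]; exists c1, c2; split=> //.
  + by apply: CoverStable sI _; rewrite -setIDAC.
  + by apply: CoverStable sI _; rewrite -setIDAC.
  move=> Y1 Y2 s1 s2 /coverable_stable[F1 f1 d1] /coverable_stable[F2 f2 d2].
  apply: (@CoverStable _ _ _ _ ((F1 :&: A1) :|: (F2 :&: A2))).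
    move=> x y /setUP[] /setIP[xF xA] /setUP[] /setIP[yF yA];
      [exact: f1|exact: ac|exact: ac'|exact: f2].
  apply: coverable_setUD; apply: h; rewrite ?setD_subset //.
  + apply: coverableS d1; apply/subsetP=> u; rewrite !inE => /andP[nu uY].
    by move: nu; rewrite uY (subsetP s1 _ uY) !andbT.
  + apply: coverableS d2; apply/subsetP=> u; rewrite !inE => /andP[nu uY].
    by move: nu; rewrite uY (subsetP s2 _ uY) !andbT.
- case: IH => c1 [c2 [[l1 l2] h1 h2 h]].
  have [x1|x1] := boolP (x \in A1).
    exists c1.+1, c2; split; first lia.
    + by apply: (CoverVertex _ _ _ _ x); rewrite -setIDAC.
    + apply: coverable_setIDr h2; apply/setP=> u; rewrite !inE.
      by case: eqP => // ->; rewrite (disjointFr dis x1).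
    move=> Y1 Y2 s1 s2 /coverable_vertex[y d1] d2.
    apply: (CoverVertex _ _ _ _ y); apply: coverable_setUDl; apply: h => //; exact: setD_subset.
  exists c1, c2.+1; split; first lia.
  + apply: coverable_setIDr h1; apply/setP=> u; rewrite !inE.
    by case: eqP => // ->; rewrite (negbTE x1).
  + by apply: (CoverVertex _ _ _ _ x); rewrite -setIDAC.
  move=> Y1 Y2 s1 s2 d1 /coverable_vertex[y d2].
  apply: (CoverVertex _ _ _ _ y); apply: coverable_setUDr; apply: h => //; exact: setD_subset.
Qed.


Lemma decompose A1 A2 X a b c : [disjoint A1 & A2] ->
  anticomplete e A1 A2 \/ complete e A1 A2 ->
  coverable X a b c -> decomposable A1 A2 X a b c.
Proof.
by move=> dis [ac|cm]; [exact: decompose_anticomplete | exact: decompose_complete].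
Qed.

(** * Counting triples and bounding witnesses *)

(* The factor is one more than an upper bound for twice the number of triples
   (a, b, c) with 2a + b + c = w. *)
Fixpoint size_bound w :=
  if w is w'.+1 then size_bound w' * (w'.+2 ^ 2 %/ 2).+1 else 1.

Lemma size_bound_gt0 w : 0 < size_bound w.
Proof. by elim: w => //= w IH; rewrite muln_gt0 IH. Qed.

(** Removing the first term leaves the same sum for [m - 2], and 4m + (m-1)^2 = (m+1)^2. *)
Lemma sum_arith n m : 4 * (\sum_(a < n) (m - 2 * a)) <= m.+1 ^ 2.
Proof.
elim: n m => [|n IH] m; first by rewrite big_ord0.
rewrite big_ord_recl; under eq_bigr => i _ do
  [have -> : m - 2 * lift ord0 i = m - 2 - 2 * i by rewrite lift0; lia].
by have := IH (m - 2); case: m => [|[|m]]; rewrite ?subn2 /=; nia.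
Qed.

Lemma sum_ltn n m : \sum_(b < n) (b < m) = minn n m.
Proof.
elim: n => [|n IH]; first by rewrite big_ord0 min0n.
by rewrite big_ord_recr /= IH; lia.
Qed.

(** At weight [w] the pair (a, b) determines c, and a fixed a allows w + 1 - 2a values of b,
    truncated at 0. *)
Lemma card_profiles w :
  2 * (\sum_(ab : 'I_w.+1 * 'I_w.+1) (2 * ab.1 + ab.2 <= w)) <= w.+2 ^ 2 %/ 2.
Proof.
rewrite leq_divRL // -(pair_bigA _ (fun a b : 'I_w.+1 => (2 * a + b <= w) : nat)) /=.
set S := \sum_i _.
suff : S <= \sum_(a < w.+1) (w.+1 - 2 * a) by have := sum_arith w.+1 w.+1; lia.
apply: leq_sum => a _.
rewrite (eq_bigr (fun b : 'I_w.+1 => (b < w.+1 - 2 * a) : nat)).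
  by rewrite sum_ltn geq_minr.
by move=> b _; congr nat_of_bool; lia.
Qed.

(** [B] is the union of witnesses for all failing triples of weight below [w]. The factor 2 in the
    size bound lets the witnesses of two parts fit together into [size_bound w]. *)
Lemma witness_below A w :
  (forall a b c, 2 * a + b + c < w -> ~ coverable A a b c -> exists2 B : {set T},
     B \subset A & ~ coverable B a b c /\ #|B| <= size_bound (2 * a + b + c)) ->
  exists2 B : {set T}, B \subset A & 2 * #|B| < size_bound w /\
    forall a b c, 2 * a + b + c < w -> coverable B a b c -> coverable A a b c.
Proof.
elim: w => [|w IHw] wit; first by exists set0; rewrite ?sub0set // cards0.
have [|B sB [cB hB]] := IHw; first by move=> a b c lt; apply: wit; lia.
(* The third entry is what [a] and [b] leave of [w]. Pairs that are too heavy, or for which [A] is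
   coverable, receive the empty set. *)
have /fin_all_exists[f hf] (ab : 'I_w.+1 * 'I_w.+1) : exists D : {set T},
    [/\ D \subset A, #|D| <= (2 * ab.1 + ab.2 <= w) * size_bound w
      & 2 * ab.1 + ab.2 <= w -> coverable D ab.1 ab.2 (w - (2 * ab.1 + ab.2)) ->
          coverable A ab.1 ab.2 (w - (2 * ab.1 + ab.2))].
  have [le|nle] := leqP (2 * ab.1 + ab.2) w; last by exists set0; rewrite sub0set cards0.
  have [cA|ncA] := classic (coverable A ab.1 ab.2 (w - (2 * ab.1 + ab.2))).
    by exists set0; rewrite sub0set cards0.
  have [|D sD [ncD cD]] := wit _ _ _ _ ncA; first by rewrite subnKC.
  by exists D; rewrite mul1n; split=> //; rewrite subnKC in cD.
exists (B :|: \bigcup_ab f ab).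
  by rewrite subUset sB; apply/bigcupsP=> ab _; case: (hf ab).
split.
  have lef : #|\bigcup_ab f ab| <=
      (\sum_(ab : 'I_w.+1 * 'I_w.+1) (2 * ab.1 + ab.2 <= w)) * size_bound w.
    rewrite big_distrl /=; elim/big_ind2: _ => [|n D m D' le1 le2|ab _]; first by rewrite cards0.
    - by apply: leq_trans (leq_add le1 le2); rewrite cardsU leq_subr.
    - by case: (hf ab).
  rewrite cardsU /= mulnS.
  have := leq_mul (leqnn (size_bound w)) (card_profiles w).
  move: lef; set S := \sum_ab _; rewrite mulnCA [size_bound w * S]mulnC.
  move: (S * _) (size_bound w * _) => P Q; move: cB; set U := \bigcup_ab f ab.
  by move: (size_bound w) #|U| #|B| #|B :&: U|; clear; lia.
move=> a b c; rewrite ltnS leq_eqVlt => /predU1P[def|lt]; last first.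
  by move=> cov; apply: hB => //; apply: coverableS cov; apply: subsetUl.
have [ltaw ltbw] : a < w.+1 /\ b < w.+1 by lia.
case: (hf (Ordinal ltaw, Ordinal ltbw)) => _ _ /=.
have -> : w - (2 * a + b) = c by lia.
move=> h cov; apply: h; first lia.
apply: coverableS cov; apply: subset_trans (subsetUr _ _).
exact: (bigcup_sup (Ordinal ltaw, Ordinal ltbw)).
Qed.

Lemma small_witness A a b c : cograph e -> ~ coverable A a b c ->
  exists2 B : {set T}, B \subset A & ~ coverable B a b c /\ #|B| <= size_bound (2 * a + b + c).
Proof.
move=> ec; have [n] := ubnP #|A|; elim: n A a b c => // n IH A a b c An ncA.
have [small|big] := leqP #|A| 1.
  by exists A => //; split=> //; apply: leq_trans small (size_bound_gt0 _).
have [A1 [A2 [n1 n2 dis def h]]] := cograph_splits A es ec big.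
have cA : #|A1| + #|A2| = #|A|.
  by rewrite -def; apply/esym/eqP; rewrite (leq_card_setU A1 A2).2.
have [l1 l2] : #|A1| < n /\ #|A2| < n by move: n1 n2; rewrite -!card_gt0; lia.
have [s1 s2] : A1 \subset A /\ A2 \subset A by rewrite -def subsetUl subsetUr.
have [c1|nc1] := classic (coverable A1 a b c); last first.
  by have [B sB hB] := IH A1 _ _ _ l1 nc1; exists B => //; apply: subset_trans s1.
have [c2|nc2] := classic (coverable A2 a b c); last first.
  by have [B sB hB] := IH A2 _ _ _ l2 nc2; exists B => //; apply: subset_trans s2.
have [|B1 sB1 [cB1 hB1]] := witness_below A1 (2 * a + b + c).
  by move=> a' b' c' _; apply: IH.
have [|B2 sB2 [cB2 hB2]] := witness_below A2 (2 * a + b + c).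
  by move=> a' b' c' _; apply: IH.
exists (B1 :|: B2); first by rewrite -def setUSS.
split; last by rewrite cardsU; lia.
(* A cover of [B1 :|: B2] would split between the parts; the choice of [B1] and [B2] lifts both
   pieces to covers of [A1] and [A2], which recombine into a cover of [A]. *)
case/(decompose A1 A2 _ _ _ _ dis h)=> a1 [b1 [k1 [a2 [b2 [k2 [[d1 d2] h1 h2 hU]]]]]].
apply: ncA; rewrite -def; apply: hU => //.
- case: d1 => [lt|[-> [-> ->]] //]; apply: hB1 => //; apply: coverableS h1.
  by rewrite subsetI subsetUl.
- case: d2 => [lt|[-> [-> ->]] //]; apply: hB2 => //; apply: coverableS h2.
  by rewrite subsetI subsetUr.
Qed.

(** * Covers by forests and forest partitions *)

Lemma coverable_bigcup p (V : 'I_p -> {set T}) A : A \subset \bigcup_(i < p) V i ->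
  (forall i, induces_forest e (V i)) -> coverable A p 0 0.
Proof.
elim: p V A => [|p IH] V A sA fV.
  by move: sA; rewrite big_ord0 subset0 => /eqP->; apply: Cover0.
apply: CoverForest (fV ord0) _; apply: (IH (fun i => V (lift ord0 i))) => //.
by rewrite subDset -big_ord_recl.
Qed.

Lemma coverable_partitionable p A : coverable A p 0 0 -> forest_partitionable e p A.
Proof.
elim: p A => [|p IH] A.
  move/coverable_set0->; exists (fun _ => set0); split; last by case.
    by rewrite big_ord0.
  by case.
case/coverable_forest=> F fF /IH[V [def dis fV]].
(* [F] may reach outside [A], whereas the classes must have union exactly [A]. *)
exists (fun i => if unlift ord0 i is Some j then V j else A :&: F); split.
- rewrite big_ord_recl unlift_none; under eq_bigr => i _ do rewrite liftK.
  by rewrite def setID.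
- have disF j : [disjoint A :&: F & V j].
    have sV : V j \subset A :\: F by rewrite -def; apply: bigcup_sup.
    rewrite -setI_eq0 -subset0; apply/subsetP=> x /setIP[/setIP[_ xF] /(subsetP sV)].
    by rewrite !inE xF.
  move=> i j; case: unliftP => [i' ->|->]; case: unliftP => [j' ->|->].
  + by rewrite (inj_eq lift_inj); apply: dis.
  + by rewrite disjoint_sym.
  + by [].
  + by rewrite eqxx.
- by move=> i; case: unlift => [j|] //; apply: forestS fF; apply: subsetIr.
Qed.

End Cograph.

(** * The factorial bound *)

Lemma size_bound_fact w : size_bound w <= 4 * w`! ^ 2.
Proof.
(* The growth factor exceeds (w+1)^2 in the first two steps, where the constant 4 absorbs it: 3 <= 4
   and 15 <= 16. From [w = 2] on, the factor is at most (w+1)^2. *)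
elim: w => // -[|[|w]] IH //.
have -> : size_bound w.+3 = size_bound w.+2 * (w.+4 ^ 2 %/ 2).+1 by [].
rewrite factS expnMn mulnCA mulnC; apply: leq_mul => //.
by rewrite -addn1 -leq_subRL; lia.
Qed.

Theorem theorem10 :
  exists C : nat, 0 < C /\
    forall (p : nat) (T : finType) (e : rel T),
      0 < p -> simple_graph e -> minimal_cograph_obstruction e p ->
      #|T| <= C * ((2 * p)`!) ^ 2.
Proof.
exists 4; split=> // p T e _ [es ei] [ec nT minT].
have [|B _ [ncB cB]] := small_witness T e es ei [set: T] p 0 0 ec.
  by move/coverable_partitionable.
rewrite !addn0 in cB; apply: leq_trans (size_bound_fact _); apply: leq_trans cB.
(* By minimality every proper subset is partitionable, so the uncoverable [B] must be the whole
   vertex set. *)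
have [BT|nBT] := eqVneq B [set: T]; first by rewrite BT cardsT.
have [|V [def _ fV]] := minT B; first by rewrite properT.
by case: ncB; apply: (coverable_bigcup _ _ _ V) => //; rewrite def.
Qed.
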